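(* (i) For every Kleene algebra $\mathcal{K}$ there exists a Boolean algebra $\mathcal{B}_{\mathcal{K}}$ such that $\mathcal{K}$ can be embedded (as a Kleene algebra) into $\mathcal{B}_{\mathcal{K}}^{[2]}$. (ii) Equivalently, every Kleene algebra is isomorphic to an algebra of rough sets in a Pawlak approximation space; that is, for every Kleene algebra $\mathcal{K}$ there exists an approximation space $(U,R)$ such that $\mathcal{K}$ can be embedded (as a Kleene algebra) into the Kleene algebra $\mathcal{RS}$ of rough sets in $(U,R)$.
   Context: A Kleene algebra is an algebra $(K,\vee,\wedge,\sim,0,1)$ such that $(K,\vee,\wedge,0,1)$ is a bounded distributive lattice and, for all $a,b\in K$: $\sim(a\wedge b)=\sim a\vee\sim b$, $\sim\sim a=a$, and $a\wedge\sim a\le b\vee\sim b$. Embeddings and isomorphisms of Kleene algebras preserve $\vee,\wedge,\sim,0,1$. For a Boolean algebra $\mathcal{B}=(B,\vee,\wedge,{}^{c},0,1)$, let $B^{[2]}:=\{(a,b): a,b\in B,\ a\le b\}$, and let $\mathcal{B}^{[2]}$ be the Kleene algebra $(B^{[2]},\vee,\wedge,\sim,(0,0),(1,1))$ with $\vee,\wedge$ defined componentwise and $\sim(a,b):=(b^{c},a^{c})$. A (Pawlak) approximation space is a pair $(U,R)$ with $U$ a set and $R$ an equivalence relation on $U$; $[x]$ denotes the $R$-class of $x$. For $A\subseteq U$, the lower and upper approximations are $\mathsf{L}A:=\bigcup\{[x]:[x]\subseteq A\}$ and $\mathsf{U}A:=\bigcup\{[x]:[x]\cap A\neq\emptyset\}$.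 A rough set in $(U,R)$ is a pair $(\mathsf{L}A,\mathsf{U}A)$ with $A\subseteq U$, and $\mathcal{RS}:=\{(\mathsf{L}A,\mathsf{U}A):A\subseteq U\}$. $\mathcal{RS}$ forms a Kleene algebra under componentwise union and intersection, $\sim(D_1,D_2):=(U\setminus D_2,U\setminus D_1)$, least element $(\emptyset,\emptyset)$ and greatest element $(U,U)$. *)

(* Defs.v *)
From HB Require Import structures.
From mathcomp Require Import all_boot all_order.
From mathcomp Require Import boolp classical_sets.
From Stdlib Require Import RelationClasses.

Set Implicit Arguments.
Unset Strict Implicit.
Unset Printing Implicit Defensive.

Import Order.Theory.
Local Open Scope order_scope.

(* The structure does not require \bot != \top, so the one-element algebra is
   a Kleene algebra. *)
HB.mixin Record TBDistrLattice_isKleene (d : Order.disp_t) T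
    of Order.TBDistrLattice d T := {
  kneg : T -> T;
  knegI : forall a b : T, kneg (a `&` b) = kneg a `|` kneg b;
  knegK : forall a : T, kneg (kneg a) = a;
  kneg_normal : forall a b : T, a `&` kneg a <= b `|` kneg b;
}.

#[short(type="kleeneAlgType")]
HB.structure Definition KleeneAlg (d : Order.disp_t) :=
  { T of TBDistrLattice_isKleene d T & Order.TBDistrLattice d T }.

Record kleene_embedding (d d' : Order.disp_t)
    (K : kleeneAlgType d) (K' : kleeneAlgType d') (f : K -> K') : Prop := {
  kemb_inj : injective f;
  kemb_join : forall a b : K, f (a `|` b) = f a `|` f b;
  kemb_meet : forall a b : K, f (a `&` b) = f a `&` f b;
  kemb_neg : forall a : K, f (kneg a) = kneg (f a);
  kemb_bot : f \bot = \bot;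
  kemb_top : f \top = \top;
}.

Section OrderedPairs.
Variables (d : Order.disp_t) (B : ctbDistrLatticeType d).

(* [ctbDistrLatticeType] is the type of Boolean algebras, with complement ~`,
   and [B *p B] is B * B with the componentwise order. *)
Definition le_pair : {pred B *p B} := fun p => p.1 <= p.2.

Fact le_pairI : {in le_pair &, forall p q, p `&` q \in le_pair}.
Proof. by move=> [a b] [a' b'] h h'; exact: (leI2 h h'). Qed.

Fact le_pairU : {in le_pair &, forall p q, p `|` q \in le_pair}.
Proof. by move=> [a b] [a' b'] h h'; exact: (leU2 h h'). Qed.

Fact le_pair0 : \bot \in le_pair.
Proof. exact: (@lexx _ B). Qed.

Fact le_pair1 : \top \in le_pair.
Proof. exact: (@lexx _ B). Qed.

HB.instance Definition _ := Order.isTBLatticeClosed.Build _ (B *p B)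
  le_pair le_pairI le_pairU le_pair0 le_pair1.

Record ordpair := OrdPair { ordpair_val : B *p B; _ : ordpair_val \in le_pair }.

HB.instance Definition _ := [isSub for ordpair_val].
HB.instance Definition _ := [Choice of ordpair by <:].
HB.instance Definition _ := [SubChoice_isTBSubLattice of ordpair by <: with d].

Lemma ordpair_meetE (x y : ordpair) : ordpair_val (x `&` y) =
  ((ordpair_val x).1 `&` (ordpair_val y).1,
   (ordpair_val x).2 `&` (ordpair_val y).2).
Proof. by []. Qed.

Lemma ordpair_joinE (x y : ordpair) : ordpair_val (x `|` y) =
  ((ordpair_val x).1 `|` (ordpair_val y).1,
   (ordpair_val x).2 `|` (ordpair_val y).2).
Proof. by []. Qed.

Lemma ordpair_botE : ordpair_val \bot = (\bot, \bot).
Proof. by []. Qed.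

Lemma ordpair_topE : ordpair_val \top = (\top, \top).
Proof. by []. Qed.

Fact ordpair_meetUl : @left_distributive ordpair ordpair Order.meet Order.join.
Proof.
by move=> x y z; apply: val_inj => /=; exact: meetUl.
Qed.

Fact ordpair_joinIl : @left_distributive ordpair ordpair Order.join Order.meet.
Proof.
by move=> x y z; apply: val_inj => /=; exact: joinIl.
Qed.

HB.instance Definition _ := Order.Lattice_isDistributive.Build d ordpair
  ordpair_meetUl ordpair_joinIl.

Fact ordpair_neg_subproof (x : ordpair) :
  ((~` (ordpair_val x).2, ~` (ordpair_val x).1) : B *p B) \in le_pair.
Proof. by case: x => [[a b] ab]; rewrite unfold_in /= lexC complK. Qed.

Definition ordpair_neg (x : ordpair) : ordpair := OrdPair (ordpair_neg_subproof x).

Fact ordpair_negI (x y : ordpair) :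
  ordpair_neg (x `&` y) = ordpair_neg x `|` ordpair_neg y.
Proof.
by apply: val_inj; rewrite /= !complI.
Qed.

Fact ordpair_negK (x : ordpair) : ordpair_neg (ordpair_neg x) = x.
Proof. by apply: val_inj; case: x => [[a b] ab] /=; rewrite !complK. Qed.

Fact ordpair_neg_normal (x y : ordpair) :
  x `&` ordpair_neg x <= y `|` ordpair_neg y.
Proof.
change (val (x `&` ordpair_neg x) <= val (y `|` ordpair_neg y)).
case: x y => [[a b] ab] [[a' b'] ab'] /=.
rewrite unfold_in /= in ab; rewrite unfold_in /= in ab'.
have h1 : a `&` ~` b = \bot.
  by apply/eqP; rewrite -lex0 -(meetxC b) leI2.
have h2 : b' `|` ~` a' = \top.
  by apply/eqP; rewrite -le1x -(joinxC a') leU2.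
change ((a `&` ~` b <= a' `|` ~` b') && (b `&` ~` a <= b' `|` ~` a')).
by rewrite h1 h2 le0x lex1.
Qed.

HB.instance Definition _ := TBDistrLattice_isKleene.Build d ordpair
  ordpair_negI ordpair_negK ordpair_neg_normal.

End OrderedPairs.

Local Open Scope classical_set_scope.

Record approxSpace := ApproxSpace {
  approx_sort :> Type;
  indisc : approx_sort -> approx_sort -> Prop;
  indisc_equiv : Equivalence indisc;
}.

Section RoughSets.
Variable S : approxSpace.
Implicit Types (A D E : set S) (x y z : S).

Definition iclass x : set S := [set y | indisc x y].

Definition lower A : set S := \bigcup_(x in [set x | iclass x `<=` A]) iclass x.

Definition upper A : set S :=
  \bigcup_(x in [set x | iclass x `&` A !=set0]) iclass x.

Fact ixx x : indisc x x.
Proof. by case: (indisc_equiv S) => r _ _; apply: r. Qed.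

Fact isym x y : indisc x y -> indisc y x.
Proof. by case: (indisc_equiv S) => _ s _; apply: s. Qed.

Fact itrans x y z : indisc x y -> indisc y z -> indisc x z.
Proof. by case: (indisc_equiv S) => _ _ t; apply: t. Qed.

Lemma lowerP A x : lower A x <-> (forall y, indisc x y -> A y).
Proof.
split=> [[z zA zx] y xy|h]; first exact: zA (itrans zx xy).
by exists x => //; exact: ixx.
Qed.

Lemma upperP A x : upper A x <-> exists2 y, indisc x y & A y.
Proof.
split=> [[z [y [zy Ay]] zx]|[y xy Ay]].
  by exists y => //; exact: itrans (isym zx) zy.
by exists x; [exists y|exact: ixx].
Qed.

Definition rough : {pred set S *p set S} :=
  [pred D | `[< exists A, D = (lower A, upper A) >]].

Lemma roughE D E : (((D, E) : set S *p set S) \in rough) <->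
  [/\ D `<=` E, forall x y, indisc x y -> D x -> D y,
      forall x y, indisc x y -> E x -> E y
    & forall x, E x -> ~ D x -> exists2 y, indisc x y & y <> x].
Proof.
rewrite unfold_in /=; split=> [/asboolP[A [-> ->]]|[DE Dc Ec sing]].
  split.
  - by move=> x /lowerP h; apply/upperP; exists x; [|apply: h]; exact: ixx.
  - move=> x y xy /lowerP h; apply/lowerP => z yz; apply: h.
    exact: itrans xy yz.
  - move=> x y xy /upperP[z xz Az]; apply/upperP; exists z => //.
    exact: itrans (isym xy) xz.
  - move=> x /upperP[y xy Ay] nL; have [yx|] := pselect (y = x); last by exists y.
    apply: contrapT => nz; apply: nL; apply/lowerP => z xz.
    have [->|nzx] := pselect (z = x); first by rewrite -yx.
    by case: nz; exists z.
have ne x : exists y, iclass x y by exists x; exact: ixx.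
pose rep x := projT1 (cid (ne x)).
have repP x : indisc x (rep x) by rewrite /rep; case: cid.
have rep_eq x y : indisc x y -> rep x = rep y.
  move=> xy; rewrite /rep; have e : iclass x = iclass y.
    apply/seteqP; split=> z h; first exact: itrans (isym xy) h.
    exact: itrans xy h.
  by move: (ne x) (ne y); rewrite e => p q; rewrite (Prop_irrelevance p q).
apply/asboolP; exists (D `|` [set x | E x /\ rep x = x]).
congr pair; apply/seteqP; split=> x.
- by move=> Dx; apply/lowerP => y xy; left; exact: Dc xy Dx.
- move=> /lowerP h; apply: contrapT => nD.
  have nDc y : indisc x y -> ~ D y by move=> xy Dy; apply/nD/(Dc y) => //; exact: isym.
  have [//|[Ex rx]] := h x (ixx x).
  have [y xy] := sing x Ex nD; apply.
  have [/(nDc y xy)//|[_ ry]] := h y xy.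
  by rewrite -ry -rx; apply/esym/rep_eq.
- move=> Ex; apply/upperP; exists (rep x) => //; right; split.
    exact: Ec (repP x) Ex.
  exact/esym/rep_eq.
- move=> /upperP[y xy [Dy|[Ey _]]]; first by apply/DE/(Dc y) => //; exact: isym.
  by apply/(Ec y) => //; exact: isym.
Qed.

Fact roughI : {in rough &, forall p q, p `&` q \in rough}%O.
Proof.
move=> [D E] [D' E'] /roughE[DE Dc Ec s] /roughE[DE' Dc' Ec' s'].
apply/roughE; split.
- by move=> x [/DE ? /DE' ?]; split.
- by move=> x y xy [? ?]; split; [exact: Dc xy _|exact: Dc' xy _].
- by move=> x y xy [? ?]; split; [exact: Ec xy _|exact: Ec' xy _].
- move=> x [Ex Ex'] n; have [Dx|nD] := pselect (D x); last exact: s.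
  by apply: s' => // Dx'; apply: n.
Qed.

Fact roughU : {in rough &, forall p q, p `|` q \in rough}%O.
Proof.
move=> [D E] [D' E'] /roughE[DE Dc Ec s] /roughE[DE' Dc' Ec' s'].
apply/roughE; split.
- by move=> x [/DE ?|/DE' ?]; [left|right].
- by move=> x y xy [?|?]; [left; exact: Dc xy _|right; exact: Dc' xy _].
- by move=> x y xy [?|?]; [left; exact: Ec xy _|right; exact: Ec' xy _].
- by move=> x [Ex|Ex] n; [apply: s|apply: s'] => // Dx; apply: n; [left|right].
Qed.

Fact rough0 : (\bot \in rough)%O.
Proof. by apply/roughE; split. Qed.

Fact rough1 : (\top \in rough)%O.
Proof. by apply/roughE; split=> // x _ []. Qed.

HB.instance Definition _ := Order.isTBLatticeClosed.Build _ (set S *p set S)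
  rough roughI roughU rough0 rough1.

Record roughset := RoughSet {
  roughset_val : set S *p set S; _ : roughset_val \in rough }.

HB.instance Definition _ := [isSub for roughset_val].
HB.instance Definition _ := [Choice of roughset by <:].
HB.instance Definition _ :=
  [SubChoice_isTBSubLattice of roughset by <: with set_display].

Lemma roughset_meetE (x y : roughset) : roughset_val (x `&` y)%O =
  ((roughset_val x).1 `&` (roughset_val y).1,
   (roughset_val x).2 `&` (roughset_val y).2).
Proof. by []. Qed.

Lemma roughset_joinE (x y : roughset) : roughset_val (x `|` y)%O =
  ((roughset_val x).1 `|` (roughset_val y).1,
   (roughset_val x).2 `|` (roughset_val y).2).
Proof. by []. Qed.

Lemma roughset_botE : roughset_val \bot%O = (set0, set0).
Proof. by []. Qed.

Lemma roughset_topE : roughset_val \top%O = (setT, setT).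
Proof. by []. Qed.

Fact roughset_meetUl : @left_distributive roughset roughset Order.meet Order.join.
Proof.
by move=> x y z; apply: val_inj => /=; exact: meetUl.
Qed.

Fact roughset_joinIl : @left_distributive roughset roughset Order.join Order.meet.
Proof.
by move=> x y z; apply: val_inj => /=; exact: joinIl.
Qed.

HB.instance Definition _ := Order.Lattice_isDistributive.Build set_display
  roughset roughset_meetUl roughset_joinIl.

Fact roughset_neg_subproof (x : roughset) :
  ((~` (roughset_val x).2, ~` (roughset_val x).1) : set S *p set S) \in rough.
Proof.
case: x => [[D E] /= /roughE[DE Dc Ec s]]; apply/roughE; split.
- by move=> x nE /DE.
- by move=> x y /isym xy nE /(Ec _ _ xy).
- by move=> x y /isym xy nD /(Dc _ _ xy).
- by move=> x nD /contrapT Ex; exact: s.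
Qed.

Definition roughset_neg (x : roughset) : roughset :=
  RoughSet (roughset_neg_subproof x).

Fact roughset_negI (x y : roughset) :
  roughset_neg (x `&` y)%O = (roughset_neg x `|` roughset_neg y)%O.
Proof.
by apply: val_inj; rewrite /= !meetEset !setCI.
Qed.

Fact roughset_negK (x : roughset) : roughset_neg (roughset_neg x) = x.
Proof. by apply: val_inj; case: x => [[D E] h] /=; rewrite !setCK. Qed.

Fact roughset_neg_normal (x y : roughset) :
  (x `&` roughset_neg x <= y `|` roughset_neg y)%O.
Proof.
change (val (x `&` roughset_neg x)%O <= val (y `|` roughset_neg y)%O)%O.
case: x y => [[D E] /= /roughE[DE _ _ _]] [[D' E'] /= /roughE[DE' _ _ _]].
apply/andP; split; apply/asboolP => z /=; first by move=> [/DE ? []].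
by move=> _; have [/DE'|] := pselect (D' z); [left|right].
Qed.

HB.instance Definition _ := TBDistrLattice_isKleene.Build set_display roughset
  roughset_negI roughset_negK roughset_neg_normal.

End RoughSets.

(* Main.v *)
Require Import Defs.
From HB Require Import structures.
From mathcomp Require Import all_boot all_order.
From mathcomp Require Import boolp classical_sets.

(** Send a prime filter [P] of a Kleene algebra to the prime filter
    [g P = {a | ~a \notin P}]. The map [g] is an involution, and the Kleene
    inequality says that [P] and [g P] are always comparable. On the set [X] of
    the [P] with [P `<=` g P], the map
    [a |-> ({P | a \in P}, {P | a \in g P})] is a homomorphism into the ordered
    pairs of subsets of [X]. It is injective since a prime filter separating two
    elements is either in [X], so that the first components differ, or of the
    form [g P] with [P] in [X], so that the second components differ.
    Finally, doubling each point of [X] yields an approximation space without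
    singleton classes, in which every ordered pair of unions of classes is a
    rough set. *)

Set Implicit Arguments.
Unset Strict Implicit.
Unset Printing Implicit Defensive.

Import Order.Theory.
Local Open Scope classical_set_scope.
Local Open Scope order_scope.

Record prime_filter (d : Order.disp_t) (L : tbLatticeType d) (F : set L) :
  Prop := PrimeFilter {
  pf_top : F \top;
  pf_bot : ~ F \bot;
  pf_meet : forall a b, F (a `&` b) <-> F a /\ F b;
  pf_join : forall a b, F (a `|` b) <-> F a \/ F b;
}.

Section PrimeFilterTheorem.
Variables (d : Order.disp_t) (L : tbDistrLatticeType d).
Implicit Types (a b x y z : L) (F : set L).

Lemma pf_le F a b : prime_filter F -> a <= b -> F a -> F b.
Proof.
by move=> pF /join_idPl ab Fa; rewrite -ab; apply/(pf_join pF); right.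
Qed.

(* The empty set is allowed so that empty chains have an upper bound. *)
Let avoiding a b F : Prop :=
  [/\ forall x y, x <= y -> F x -> F y,
      forall x y, F x -> F y -> F (x `&` y),
      ~ F b & forall x, F x -> F a].

(** Zorn's lemma gives a maximal filter through [a] that avoids [b]; maximality and distributivity
    make it prime. *)
Lemma prime_filter_separation a b :
  ~~ (a <= b) -> exists F, [/\ prime_filter F, F a & ~ F b].
Proof.
move=> nab.
have [|M [[Mup MI nMb Ma] maxM]] := @Zorn_bigcup L (avoiding a b).
  move=> C CP totC; split.
  - by move=> x y xy [F CF Fx]; exists F => //; case: (CP F CF) => up _ _ _;
      exact: up Fx.
  - move=> x y [F CF Fx] [G CG Gy].
    have [FG|GF] := totC F G CF CG.
    + by exists G => //; case: (CP G CG) => _ mG _ _; apply: mG => //; exact: FG.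
    + by exists F => //; case: (CP F CF) => _ mF _ _; apply: mF => //; exact: GF.
  - by move=> [F CF Fb]; case: (CP F CF).
  - by move=> x [F CF Fx]; exists F => //; case: (CP F CF) => _ _ _; apply; exact: Fx.
(* So far [M] could be empty, but then the principal filter of [a], which misses [b], would properly
   extend it. *)
have {}Ma : M a.
  apply: contrapT => nMa; apply: (maxM [set z | a <= z]).
    split; first by move=> x /Ma.
    by move=> /(_ a (lexx a)).
  split=> /=.
  - by move=> x y xy ax; exact: le_trans ax xy.
  - by move=> x y ax ay; rewrite lexI ax.
  - exact/negP.
  - by move=> x _; exact: lexx.
(* Otherwise the filter generated by [M] and [x] would still avoid [b], against maximality. *)
have ext x : ~ M x -> exists2 m, M m & m `&` x <= b.
  move=> nMx; apply: contrapT => nb.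
  apply: (maxM [set z | exists2 m, M m & m `&` x <= z]).
    split; first by move=> z Mz; exists z => //; exact: leIl.
    by move=> sub; apply/nMx/sub; exists a => //; exact: leIr.
  split=> //=.
  - by move=> y z yz [m Mm my]; exists m => //; exact: le_trans my yz.
  - move=> y z [m Mm my] [n Mn nz]; exists (m `&` n); first exact: MI.
    rewrite lexI; apply/andP; split.
      by apply: le_trans my; apply: leI2 => //; exact: leIl.
    by apply: le_trans nz; apply: leI2 => //; exact: leIr.
  - by move=> y _; exists a => //; exact: leIl.
exists M; split=> //; split.
- exact: Mup (lex1 a) Ma.
- by move=> M0; apply: nMb; exact: Mup (le0x b) M0.
- move=> x y; split=> [Mxy|[Mx My]]; last exact: MI.
  by split; apply: Mup Mxy; [exact: leIl|exact: leIr].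
- move=> x y; split=> [Mxy|[Mx|My]].
  (* If both [x] and [y] lay outside [M], distributivity would put the meet of [m], [n] and the join
     of [x] and [y] below [b], forcing [b] into [M]. *)
  + apply: contrapT => /not_orP[/ext[m Mm mx] /ext[n Mn ny]]; apply: nMb.
    apply: (Mup ((m `&` n) `&` (x `|` y))); last by apply: (MI) => //; exact: MI.
    rewrite meetUr leUx; apply/andP; split.
      by apply: le_trans mx; apply: leI2 => //; exact: leIl.
    by apply: le_trans ny; apply: leI2 => //; exact: leIr.
  + by apply: Mup Mx; exact: leUl.
  + by apply: Mup My; exact: leUr.
Qed.

End PrimeFilterTheorem.

Section Duality.
Variables (d : Order.disp_t) (K : kleeneAlgType d).
Implicit Types (a b : K) (F : set K).

Lemma knegU a b : kneg (a `|` b) = kneg a `&` kneg b.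
Proof. by rewrite -[RHS]knegK knegI !knegK. Qed.

(** Because ~0 = ~(0 ∧ ~1) = ~0 ∨ 1. *)
Lemma kneg0 : kneg (\bot : K) = \top.
Proof. by rewrite -(meet0x (kneg \top)) knegI knegK joinx1. Qed.

Lemma kneg1 : kneg (\top : K) = \bot.
Proof. by rewrite -kneg0 knegK. Qed.

Definition kdual F : set K := [set a | ~ F (kneg a)].

Lemma kdualK F : kdual (kdual F) = F.
Proof.
by apply/seteqP; split=> a; rewrite /kdual /= knegK; [move/contrapT|move=> ? /(_ _)].
Qed.

(** Being an order-reversing involution, [kneg] maps [F] onto a prime ideal, and [kdual F] is the
    complement of that ideal. *)
Lemma kdual_prime F : prime_filter F -> prime_filter (kdual F).
Proof.
move=> pF; split; rewrite /kdual /=.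
- by rewrite kneg1; exact: pf_bot pF.
- by rewrite kneg0 => /(_ (pf_top pF)).
- by move=> a b; rewrite knegI (pf_join pF) not_orP.
- by move=> a b; rewrite knegU (pf_meet pF) not_andP.
Qed.

(** If [F] contains some [a] together with [kneg a], the Kleene inequality puts every b ∨ ~b in [F];
    by primality, [b] is in [F] as soon as [kneg b] is not. *)
Lemma kdual_comparable F : prime_filter F -> F `<=` kdual F \/ kdual F `<=` F.
Proof.
move=> pF; have [|/existsNP[a /not_implyP[Fa /contrapT Fna]]] :=
  pselect (F `<=` kdual F); first by left.
right=> b nFnb; have /(pf_le pF (kneg_normal a b)) : F (a `&` kneg a).
  exact/(pf_meet pF).
by move=> /(pf_join pF)[].
Qed.

End Duality.

Lemma kleene_embedding_comp (d1 d2 d3 : Order.disp_t) (K1 : kleeneAlgType d1)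
    (K2 : kleeneAlgType d2) (K3 : kleeneAlgType d3)
    (f : K1 -> K2) (g : K2 -> K3) :
  kleene_embedding f -> kleene_embedding g -> kleene_embedding (g \o f).
Proof.
move=> [fi fU fI fN f0 f1] [gi gU gI gN g0 g1]; split=> /=.
- exact: inj_comp.
- by move=> a b; rewrite fU gU.
- by move=> a b; rewrite fI gI.
- by move=> a; rewrite fN gN.
- by rewrite f0 g0.
- by rewrite f1 g1.
Qed.

Section PrimeFilterRepresentation.
Variables (d : Order.disp_t) (K : kleeneAlgType d).

Definition lower_prime : Type :=
  {F : set K | prime_filter F /\ F `<=` kdual F}.

Let lowset (a : K) : set lower_prime := [set P | sval P a].
Let uppset (a : K) : set lower_prime := [set P | kdual (sval P) a].

Fact prime_pair_subproof (a : K) :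
  ((lowset a, uppset a) : set lower_prime *p set lower_prime)
    \in @Defs.le_pair _ (set lower_prime).
Proof. by apply/asboolP => -[F [pF sF]] /sF. Qed.

Definition prime_pair (a : K) : ordpair (set lower_prime) :=
  OrdPair (prime_pair_subproof a).

Lemma prime_pair_embedding : kleene_embedding prime_pair.
Proof.
split.
- have le a b : prime_pair a = prime_pair b -> a <= b.
    move=> /(congr1 val)[eqL eqU]; apply: contrapT => /negP.
    move=> /prime_filter_separation[F [pF Fa nFb]].
    have [sF|sF] := kdual_comparable pF.
      have : lowset a (exist _ F (conj pF sF)) by [].
      by rewrite eqL.
    have sF' : kdual F `<=` kdual (kdual F) by rewrite kdualK.
    have : uppset a (exist _ (kdual F) (conj (kdual_prime pF) sF')).
      by rewrite /uppset /= kdualK.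
    by rewrite eqU /uppset /= kdualK.
  by move=> a b ab; apply: le_anti; rewrite !le.
- move=> a b; apply: val_inj; congr pair; apply/seteqP.
    by split=> -[F [pF sF]] /(pf_join pF).
  by split=> -[F [pF sF]] /(pf_join (kdual_prime pF)).
- move=> a b; apply: val_inj; congr pair; apply/seteqP.
    by split=> -[F [pF sF]] /(pf_meet pF).
  by split=> -[F [pF sF]] /(pf_meet (kdual_prime pF)).
(* Negation swaps and complements the components: the first equality is double negation in the
   logic, the second is [knegK]. *)
- move=> a; apply: val_inj; congr pair; rewrite complEset; apply/seteqP.
    by split=> -[F ?] /=; rewrite /lowset /uppset /kdual /=; [move=> ? /(_ _)|move/contrapT].
  by split=> -[F ?] /=; rewrite /lowset /uppset /kdual /= knegK.
- apply: val_inj; congr pair; apply/seteqP; split=> -[F [pF sF]] //.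
    by move=> /(pf_bot pF).
  by move=> /(pf_bot (kdual_prime pF)).
- apply: val_inj; congr pair; apply/seteqP; split=> -[F [pF sF]] // _.
    exact: pf_top pF.
  exact: pf_top (kdual_prime pF).
Qed.

End PrimeFilterRepresentation.

Section Doubling.
Variable X : Type.

Fact same_fst_equiv :
  RelationClasses.Equivalence (fun x y : X * bool => x.1 = y.1).
Proof. by split=> [x|x y ->|x y z -> ->]. Qed.

Definition double_space : approxSpace := ApproxSpace same_fst_equiv.

Fact double_rough_subproof (p : ordpair (set X)) :
  (((ordpair_val p).1 \o fst, (ordpair_val p).2 \o fst)
    : set double_space *p set double_space) \in @rough double_space.
Proof.
case: p => [[D E] leDE]; have DE : D `<=` E by exact/asboolP.
apply/roughE; split=> /=.
- by move=> x /DE.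
- by move=> x y ->.
- by move=> x y ->.
(* The second element of the class is the other copy of the same point. *)
- by move=> [x []] _ _; [exists (x, false)|exists (x, true)].
Qed.

Definition double_rough (p : ordpair (set X)) : roughset double_space :=
  RoughSet (double_rough_subproof p).

(** Preimage along [fst] commutes with the set operations by computation, and it is injective
    because [fst] is surjective. *)
Lemma double_rough_embedding : kleene_embedding double_rough.
Proof.
split.
- move=> p q /(congr1 val)[e1 e2]; apply: val_inj.
  case: p q e1 e2 => [[D E] h] [[D' E'] h'] /= e1 e2; congr pair.
    by apply/funext => x; exact: (congr1 (@^~ (x, true)) e1).
  by apply/funext => x; exact: (congr1 (@^~ (x, true)) e2).
- by move=> p q; apply: val_inj.
- by move=> p q; apply: val_inj.
- by move=> p; apply: val_inj.
- by apply: val_inj.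
- by apply: val_inj.
Qed.

End Doubling.

Theorem theorem1 :
  (forall (d : Order.disp_t) (K : kleeneAlgType d),
    exists (d' : Order.disp_t) (B : ctbDistrLatticeType d') (f : K -> ordpair B),
      kleene_embedding f) /\
  (forall (d : Order.disp_t) (K : kleeneAlgType d),
    exists (S : approxSpace) (f : K -> roughset S), kleene_embedding f).
Proof.
split=> d K.
  by exists _, (set (lower_prime K)), (@prime_pair d K); exact: prime_pair_embedding.
exists (double_space (lower_prime K)), (@double_rough _ \o @prime_pair d K).
exact: kleene_embedding_comp (prime_pair_embedding K) (double_rough_embedding _).
Qed.
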